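(* Let $n\ge1$, let $q\in\mathbb{N}$, and let $\{X^v\}_{v\in\mathbb{N}^n}$ be a one-critical, exhaustive $n$-parameter filtration of a cell complex $X$. If $u\in\mathbb{N}^n$ is such that $u\notin\mathcal{G}(X_{q+1})\cup\overline{\mathcal{G}(X_q)}$, then $\xi_1^q(u)=0$. In other words, $\operatorname{supp}\xi_1^q\subseteq\mathcal{G}(X_{q+1})\cup\overline{\mathcal{G}(X_q)}$.
   Context: $\mathbb{F}$ is a fixed field, $\mathbb{N}=\{0,1,\dots\}$, $e_1,\dots,e_n$ is the standard basis of $\mathbb{N}^n$, and $\preceq$ is the coordinatewise order on $\mathbb{N}^n$, with least upper bound $\bigvee$. A cell complex is a finite graded set $X=\bigsqcup_{q\in\mathbb{N}}X_q$ (elements of $X_q$ are $q$-cells) with an incidence function $\kappa:X\times X\to\mathbb{F}$ such that $\kappa(\tau,\sigma)\neq0$ implies $\dim\tau=\dim\sigma+1$, and $\sum_{\rho\in X}\kappa(\tau,\rho)\kappa(\rho,\sigma)=0$ for all $\tau,\sigma$. The face partial order $\le$ on $X$ is generated by $\sigma<\tau$ whenever $\kappa(\tau,\sigma)\ne0$. $C_*(X)$ is the chain complex with $C_q(X)$ the $\mathbb{F}$-vector space with basis $X_q$ and $\partial_q(\tau)=\sum_{\sigma\in X_{q-1}}\kappa(\tau,\sigma)\sigma$. A subcomplex is a subset closed under passing to faces, with the restricted incidence function. $H_q$ denotes homology. An $n$-parameter filtration of $X$ is a family of subcomplexes $\{X^u\}_{u\in\mathbb{N}^n}$ with $X^u\subseteq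 X^v$ for $u\preceq v$; one sets $X^w=\emptyset$ if $w\notin\mathbb{N}^n$. It is exhaustive if $X=\bigcup_uX^u$. A grade $u$ is an entrance grade of a cell $\sigma$ if $\sigma\in X^u\setminus\bigcup_{j=1}^nX^{u-e_j}$. The filtration is one-critical if $X^u=\{\sigma\in X\mid h(\sigma)\preceq u\}$ for some order-preserving $h:(X,\le)\to(\mathbb{N}^n,\preceq)$ (equivalently, every cell has exactly one entrance grade). $S=\mathbb{F}[x_1,\dots,x_n]$; $V_q=\bigoplus_{u\in\mathbb{N}^n}H_q(X^u)$ is the $n$-graded $S$-module on which $x_i$ acts by the maps $H_q(X^u)\to H_q(X^{u+e_i})$ induced by inclusion. $\xi_1^q(u)=\dim_{\mathbb{F}}(\operatorname{Tor}_1^S(V_q,\mathbb{F}))^u$, where $\mathbb{F}=S/\langle x_1,\dots,x_n\rangle$; $\operatorname{supp}\xi_1^q=\{u\mid\xi_1^q(u)\neq0\}$. $\mathcal{G}(X_q)\subseteq\mathbb{N}^n$ is the set of entrance grades of the $q$-cells, and for $G\subseteq\mathbb{N}^n$, $\overline{G}=\{\bigvee L\mid L\subseteq G\text{ finite}, L\ne\emptyset\}$. *)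

(* Defs.v *)
From HB Require Import structures.
From mathcomp Require Import all_boot all_order all_algebra.
From mathcomp.multinomials Require Import mpoly.

Set Implicit Arguments.
Unset Strict Implicit.
Unset Printing Implicit Defensive.

Import GRing.Theory.
Local Open Scope ring_scope.

(** * Subquotients and induced maps

    For [U <= W], [subquot W U] is a model of [W / U]: its carrier is a
    complement of [U] in [W], and [qclass W U], restricted to [W], is the
    canonical projection (see [qclass_eq0] and [qclass_surj]). *)

Section Subquotient.
Variable F : fieldType.

Definition subquot (vT : vectType F) (W U : {vspace vT}) : vectType F :=
  subvs_of (W :\: U)%VS.

Definition qclass (vT : vectType F) (W U : {vspace vT}) :
    'Hom(vT, subquot W U) :=
  (linfun (vsproj (W :\: U)%VS) \o addv_pi1 W U)%VF.

(* A class [c] is represented by the vector [vsval c]. When [f] maps [W] into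
   [W'] and [U] into [U'], this is the usual induced map (see [qmapE]). *)
Definition qmap (vT vT' : vectType F) (W U : {vspace vT})
    (W' U' : {vspace vT'}) (f : 'Hom(vT, vT')) :
    'Hom(subquot W U, subquot W' U') :=
  (qclass W' U' \o (f \o linfun (@vsval F vT (W :\: U)%VS)))%VF.

Lemma vsval_qclass (vT : vectType F) (W U : {vspace vT}) w :
  vsval (qclass W U w) = addv_pi1 W U w.
Proof. by rewrite comp_lfunE lfunE /= vsprojK ?memv_pi. Qed.

Lemma vsval_subquot (vT : vectType F) (W U : {vspace vT}) (c : subquot W U) :
  vsval c \in W.
Proof. exact: subvP (diffvSl W U) _ (subvsP c). Qed.

Lemma qclassK (vT : vectType F) (W U : {vspace vT}) (c : subquot W U) :
  qclass W U (vsval c) = c.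
Proof.
apply/val_inj; rewrite /= vsval_qclass.
by rewrite daddv_pi_id ?capv_diff ?subvsP.
Qed.

Lemma qclass_surj (vT : vectType F) (W U : {vspace vT}) (c : subquot W U) :
  exists2 w, w \in W & qclass W U w = c.
Proof. by exists (vsval c); [exact: vsval_subquot | exact: qclassK]. Qed.

Lemma qclass_rep (vT : vectType F) (W U : {vspace vT}) w :
  w \in W -> w - vsval (qclass W U w) \in U.
Proof.
move=> wW; have wWU : w \in (W + U)%VS by rewrite (subvP (addvSl W U)).
by rewrite vsval_qclass -{1}(addv_pi1_pi2 wWU) addrC addKr memv_pi2.
Qed.

Lemma qclass_eq0 (vT : vectType F) (W U : {vspace vT}) w :
  w \in W -> (qclass W U w == 0) = (w \in U).
Proof.
move=> wW; have wU := qclass_rep U wW.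
apply/eqP/idP => [w0 | Uw]; first by rewrite w0 subr0 in wU.
apply/val_inj/eqP; rewrite /= -memv0 -(capv_diff W U) memv_cap subvsP /=.
by rewrite -[vsval _](subKr w) memvB.
Qed.

Lemma qclass_eq (vT : vectType F) (W U : {vspace vT}) w w' :
  w \in W -> w' \in W -> w - w' \in U -> qclass W U w = qclass W U w'.
Proof.
move=> wW w'W ww'; apply/eqP; rewrite -subr_eq0 -linearB.
by rewrite qclass_eq0 //; apply: memvB.
Qed.

Lemma qmapE (vT vT' : vectType F) (W U : {vspace vT}) (W' U' : {vspace vT'})
    (f : 'Hom(vT, vT')) w :
  (f @: W <= W')%VS -> (f @: U <= U')%VS -> w \in W ->
  qmap W U W' U' f (qclass W U w) = qclass W' U' (f w).
Proof.
move=> fW fU wW.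
have -> : qmap W U W' U' f (qclass W U w) =
    qclass W' U' (f (vsval (qclass W U w))).
  rewrite /qmap (comp_lfunE (qclass _ _)) (comp_lfunE f).
  by congr (qclass _ _ (f _)); apply: lfunE.
have inW' x : x \in W -> f x \in W'.
  by move=> xW; apply: (subvP fW); apply: memv_img.
symmetry; apply: qclass_eq; rewrite ?inW' ?vsval_subquot //.
by rewrite -linearB; apply: (subvP fU); rewrite memv_img ?qclass_rep.
Qed.

End Subquotient.

(** * Cell complexes *)

Record cellComplex (F : fieldType) := CellComplex {
  cell :> finType;
  cdim : cell -> nat;
  incidence : cell -> cell -> F;
  incidence_dim : forall t s, incidence t s != 0 -> cdim t = (cdim s).+1;
  incidence_sq0 : forall t s, \sum_r incidence t r * incidence r s = 0 }.

Arguments cdim {F c} _.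
Arguments incidence {F c} _ _.

Section CellComplexTheory.
Variables (F : fieldType) (X : cellComplex F).

Definition face : rel X := connect (fun s t => incidence t s != 0).

Definition subcomplex (A : {set X}) : Prop :=
  forall s t, face s t -> t \in A -> s \in A.

(* The total space of [C_*(X)]: functions on the set of cells, a cell [s]
   being identified with the indicator function [cell_chain s]. *)
Definition chain_space : vectType F := {ffun X -> F^o}.

Definition cell_chain (s : X) : chain_space := [ffun t => (t == s)%:R].

Definition boundary_fun (f : chain_space) : chain_space :=
  [ffun s => \sum_t f t * incidence t s].

Fact boundary_fun_linear : linear boundary_fun.
Proof.
move=> a f g; apply/ffunP=> s; rewrite !ffunE scaler_sumr -big_split /=.
by apply: eq_bigr => t _; rewrite !ffunE mulrDl -scalerAl.
Qed.
HB.instance Definition _ :=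
  GRing.isLinear.Build F chain_space chain_space _ boundary_fun
    boundary_fun_linear.

Definition boundary : 'Hom(chain_space, chain_space) := linfun boundary_fun.

Lemma boundary_cell t :
  boundary (cell_chain t) = \sum_s incidence t s *: cell_chain s.
Proof.
apply/ffunP=> s; rewrite lfunE sum_ffunE !ffunE (bigD1 t) //= ffunE eqxx mul1r.
rewrite big1 ?addr0 => [|r /negPf rt]; last by rewrite ffunE rt mul0r.
rewrite (bigD1 s) //= !ffunE eqxx big1 ?addr0 => [|r rs].
  by rewrite -[_ *: _]/(_ * _) mulr1.
by rewrite !ffunE eq_sym (negPf rs) scaler0.
Qed.

(* [C_q(A)], for a subcomplex [A], as a subspace of [chain_space]; since [A]
   contains the faces of its cells, its boundary operator is the restriction
   of [boundary]. *)
Definition chains (A : {set X}) (q : nat) : {vspace chain_space} :=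
  <<[seq cell_chain s | s <- enum A & cdim s == q]>>%VS.

Definition cycles (A : {set X}) (q : nat) : {vspace chain_space} :=
  (chains A q :&: lker boundary)%VS.

Definition boundaries (A : {set X}) (q : nat) : {vspace chain_space} :=
  (boundary @: chains A q.+1)%VS.

Lemma boundaries_sub_cycles (A : {set X}) (q : nat) :
  subcomplex A -> (boundaries A q <= cycles A q)%VS.
Proof.
move=> subA; rewrite /boundaries /chains limg_span; apply/span_subvP => f.
case/mapP=> _ /mapP[t + ->] ->; rewrite mem_filter mem_enum => /andP[/eqP dt tA].
rewrite memv_cap memv_ker; apply/andP; split.
  rewrite boundary_cell; apply: memv_suml => s _.
  have [->|ts] := eqVneq (incidence t s) 0; first by rewrite scale0r mem0v.
  apply/memvZ/memv_span/map_f; rewrite mem_filter mem_enum.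
  have -> : s \in A by apply: (subA s t); first exact: connect1.
  by rewrite andbT -eqSS -dt (incidence_dim ts).
rewrite boundary_cell linear_sum; apply/eqP/ffunP => r; rewrite sum_ffunE.
under eq_bigr => s _ do rewrite linearZ /= boundary_cell ffunE sum_ffunE.
rewrite ffunE -[RHS](incidence_sq0 t r); apply: eq_bigr => s _.
rewrite (bigD1 r) //= !ffunE eqxx big1 ?addr0 => [|r' r'r].
  by rewrite -![_ *: _]/(_ * _) mulr1.
by rewrite !ffunE eq_sym (negPf r'r) scaler0.
Qed.

Definition homology (A : {set X}) (q : nat) : vectType F :=
  subquot (cycles A q) (boundaries A q).

(* The map [H_q(A) -> H_q(B)] induced by the inclusion of [A] in [B]. *)
Definition homology_incl (A B : {set X}) (q : nat) :
    'Hom(homology A q, homology B q) :=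
  qmap (cycles A q) (boundaries A q) (cycles B q) (boundaries B q) \1%VF.

Lemma chainsS (A B : {set X}) q : A \subset B -> (chains A q <= chains B q)%VS.
Proof.
move=> sAB; apply: sub_span => f /mapP[s sA ->]; apply: map_f.
have memE (C : {set X}) : (s \in [seq r <- enum C | cdim r == q]) =
    (cdim s == q) && (s \in C) by rewrite mem_filter mem_enum.
by move: sA; rewrite !memE => /andP[-> /(subsetP sAB) ->].
Qed.

Lemma cyclesS (A B : {set X}) q : A \subset B -> (cycles A q <= cycles B q)%VS.
Proof. by move=> sAB; apply: capvS (subvv _); apply: chainsS. Qed.

Lemma boundariesS (A B : {set X}) q :
  A \subset B -> (boundaries A q <= boundaries B q)%VS.
Proof. by move=> sAB; apply/limgS/chainsS. Qed.

Lemma homology_inclE (A B : {set X}) q z : A \subset B -> z \in cycles A q ->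
  homology_incl A B q (qclass (cycles A q) (boundaries A q) z) =
  qclass (cycles B q) (boundaries B q) z.
Proof.
move=> sAB zA.
by rewrite qmapE ?lim1g ?cyclesS ?boundariesS // id_lfunE.
Qed.

(** * Multifiltrations *)

Record filtration (n : nat) := Filtration {
  fsub :> 'X_{1..n} -> {set X};
  fsub_subcomplex : forall u, subcomplex (fsub u);
  fsub_mono : forall u v, (u <= v)%MM -> fsub u \subset fsub v }.

Variable n : nat.
Implicit Type (Xf : filtration n).

Definition exhaustive Xf : Prop := forall s : X, exists u, s \in Xf u.

Definition one_critical Xf : Prop :=
  exists h : X -> 'X_{1..n},
    (forall s t, face s t -> (h s <= h t)%MM) /\
    (forall u, Xf u = [set s | (h s <= u)%MM]).

(* Subtraction in ['X_{1..n}] is truncated, hence the guard: the term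
   [X^(u - e_j)] is empty when [u - e_j] is not in [N^n]. *)
Definition entrance_grade Xf (s : X) (u : 'X_{1..n}) : Prop :=
  s \in Xf u /\ forall j, (U_(j) <= u)%MM -> s \notin Xf (u - U_(j))%MM.

Definition entrance_grades Xf (q : nat) (u : 'X_{1..n}) : Prop :=
  exists2 s : X, cdim s = q & entrance_grade Xf s u.

End CellComplexTheory.

(* The least upper bound of the monomial exponents in [L] is their iterated
   [mlcm] (coordinatewise maximum), whose neutral element is [0]. *)
Definition join_closure (n : nat) (G : 'X_{1..n} -> Prop) (u : 'X_{1..n}) :
    Prop :=
  exists L : seq 'X_{1..n},
    [/\ L <> [::], forall v, v \in L -> G v & u = \big[@mlcm n/0%MM]_(v <- L) v].

(** * Multigraded modules over [S = F[x_1, ..., x_n]]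

    An n-graded S-module, with finite-dimensional homogeneous components, is
    given by its component [M u] in each degree [u] and, for [u <= v], by
    multiplication by the monomial [x^(v - u)] from [M u] to [M v]. Thus
    [gmul M u (u + U_(i))] is the action of the variable [x_i] in degree [u].
    The value of [gmul M u v] is irrelevant when [u <= v] does not hold. *)

Record gmodule (F : fieldType) (n : nat) := GModule {
  gpart :> 'X_{1..n} -> vectType F;
  gmul : forall u v, 'Hom(gpart u, gpart v);
  gmul_id : forall u m, gmul u u m = m;
  gmul_comp : forall u v w, (u <= v)%MM -> (v <= w)%MM ->
    forall m, gmul v w (gmul u v m) = gmul u w m }.

Arguments gmul {F n} g u v.

(* Degree-preserving S-linear maps. *)
Record gmorphism (F : fieldType) (n : nat) (M N : gmodule F n) := GMorphism {
  gfun :> forall u, 'Hom(M u, N u);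
  gfunM : forall u v, (u <= v)%MM ->
    forall m, gfun v (gmul M u v m) = gmul N u v (gfun u m) }.

Section Homology.
Variables (F : fieldType) (X : cellComplex F) (n : nat).
Variables (Xf : filtration X n) (q : nat).

Fact homology_module_id u m : homology_incl (Xf u) (Xf u) q m = m.
Proof. by case: (qclass_surj m) => z zA <-; rewrite homology_inclE. Qed.

Fact homology_module_comp u v w : (u <= v)%MM -> (v <= w)%MM -> forall m,
  homology_incl (Xf v) (Xf w) q (homology_incl (Xf u) (Xf v) q m) =
  homology_incl (Xf u) (Xf w) q m.
Proof.
move=> uv vw m; case: (qclass_surj m) => z zA <-.
have [sAB sBC] := (fsub_mono Xf uv, fsub_mono Xf vw).
rewrite !homology_inclE ?(subset_trans sAB sBC) //.
exact: (subvP (cyclesS q sAB)).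
Qed.

(* The module [V_q]. *)
Definition homology_module : gmodule F n :=
  GModule homology_module_id homology_module_comp.

End Homology.

(** * Free resolutions and Tor *)

Section Resolutions.
Variables (F : fieldType) (n : nat).
Implicit Types M N P : gmodule F n.

Definition grades_below (u : 'X_{1..n}) : seq 'X_{1..n} :=
  [seq bmnm w | w <- enum {: 'X_{1..n < (mdeg u).+1}} & (bmnm w <= u)%MM].

Lemma mem_grades_below u v : (v \in grades_below u) = (v <= u)%MM.
Proof.
apply/mapP/idP => [[w + ->]|vu]; first by rewrite mem_filter => /andP[].
have dv : (mdeg v < (mdeg u).+1)%N.
  by rewrite ltnS -(submK vu) mdegD leq_addl.
by exists (BMultinom dv); rewrite // mem_filter mem_enum inE vu.
Qed.

Lemma grades_below_uniq u : uniq (grades_below u).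
Proof.
by rewrite map_inj_uniq; [rewrite filter_uniq ?enum_uniq | exact: val_inj].
Qed.

(* [P] is free with homogeneous basis [gens], where [gens v] lists the basis
   elements of degree [v]: the multiples [x^(u - v) b], for [b] a generator of
   degree [v <= u], form a vector space basis of [P u]. *)
Definition free_on P (gens : forall v, seq (P v)) : Prop :=
  forall u, basis_of fullv
    (flatten [seq [seq gmul P v u b | b <- gens v] | v <- grades_below u]).

Definition gfree P : Prop := exists gens, free_on (P := P) gens.

Record free_resolution M := FreeResolution {
  res :> nat -> gmodule F n;
  res_d : forall i, gmorphism (res i.+1) (res i);
  res_aug : gmorphism (res 0%N) M;
  res_free : forall i, gfree (res i);
  res_aug_surj : forall u, limg (res_aug u) = fullv;
  res_exact0 : forall u, limg (res_d 0%N u) = lker (res_aug u);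
  res_exact : forall i u, limg (res_d i.+1 u) = lker (res_d i u) }.

Arguments res_d {M} f i.

(* The degree [u] component of [<x_1, ..., x_n> M]. *)
Definition irrelevant M (u : 'X_{1..n}) : {vspace M u} :=
  (\sum_(i < n | (U_(i) <= u)%MM) limg (gmul M (u - U_(i))%MM u))%VS.

(* [M (x)_S F], where [F = S / <x_1, ..., x_n>], is [M / <x_1, ..., x_n> M]. *)
Definition tensF M (u : 'X_{1..n}) : vectType F :=
  subquot (@fullv F (M u)) (irrelevant M u).

Definition tensF_map M N (f : gmorphism M N) (u : 'X_{1..n}) :
    'Hom(tensF M u, tensF N u) :=
  qmap fullv (irrelevant M u) fullv (irrelevant N u) (f u).

Lemma irrelevant_map M N (f : gmorphism M N) u :
  (f u @: irrelevant M u <= irrelevant N u)%VS.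
Proof.
rewrite limg_sum; apply/subv_sumP => i iu; apply: subv_trans (sumv_sup i _ _).
- exact: subvv.
- exact: iu.
apply/subvP => _ /memv_imgP[_ /memv_imgP[m _ ->] ->].
by rewrite gfunM ?lem_subr // memv_img ?memvf.
Qed.

Lemma tensF_map_class M N (f : gmorphism M N) u m :
  tensF_map f u (qclass fullv (irrelevant M u) m) =
  qclass fullv (irrelevant N u) (f u m).
Proof. by rewrite qmapE ?subvf ?irrelevant_map ?memvf. Qed.

Lemma tensF_res M (P : free_resolution M) i u :
  (limg (tensF_map (res_d P i.+1) u) <= lker (tensF_map (res_d P i) u))%VS.
Proof.
apply/subvP => _ /memv_imgP[c _ ->]; case: (qclass_surj c) => p _ <-.
rewrite memv_ker tensF_map_class tensF_map_class.
have : res_d P i.+1 u p \in lker (res_d P i u).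
  by rewrite -res_exact memv_img ?memvf.
by rewrite memv_ker => /eqP->; rewrite linear0.
Qed.

(* [Tor_1^S(M, F)] in degree [u]: the homology at [P_1] of the complex
   [P (x)_S F], for a free resolution [P] of [M]. Up to isomorphism it does not
   depend on [P], which exists for every [M] (see [std_resolution]). *)
Definition tor1 M (P : free_resolution M) (u : 'X_{1..n}) : vectType F :=
  subquot (lker (tensF_map (res_d P 0) u)) (limg (tensF_map (res_d P 1) u)).

Definition xi1 M (P : free_resolution M) (u : 'X_{1..n}) : nat :=
  \dim (@fullv F (tor1 P u)).

(** ** Existence of free resolutions

    [std_resolution M] is obtained by iterating the free cover of [M] having,
    in each degree [v], one generator for each vector of a basis of [M v]. *)

Section FreeCover.
Variable M : gmodule F n.

(* A pair [(v, k)] stands for the [k]-th vector of the chosen basis of [M v]. *)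
Definition cover_gens (u : 'X_{1..n}) : seq ('X_{1..n} * nat) :=
  [seq (v, k) | v <- grades_below u, k <- iota 0 (\dim {: M v}%VS)].

Lemma mem_cover_gens u x :
  (x \in cover_gens u) = (x.1 <= u)%MM && (x.2 < \dim {: M x.1}%VS)%N.
Proof.
case: x => v k; apply/allpairsPdep/andP => /= [[v' [k' [+ + [-> ->]]]]|[vu kv]].
  by rewrite mem_grades_below mem_iota add0n => ->.
by exists v, k; rewrite mem_grades_below mem_iota add0n.
Qed.

Lemma cover_gens_uniq u : uniq (cover_gens u).
Proof.
apply: allpairs_uniq_dep => [|v _|[v k] [v' k'] _ _ /= [-> ->]] //.
  exact: grades_below_uniq.
exact: iota_uniq.
Qed.

Definition cover_part (u : 'X_{1..n}) : vectType F :=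
  {ffun seq_sub (cover_gens u) -> F^o}.

Definition coverE u (f : cover_part u) (x : 'X_{1..n} * nat) : F :=
  if insub x is Some t then f t else 0.

Lemma coverE_val u (f : cover_part u) t : coverE f (val t) = f t.
Proof. by rewrite /coverE valK. Qed.

Lemma coverE_out u (f : cover_part u) x :
  x \notin cover_gens u -> coverE f x = 0.
Proof. by move=> xu; rewrite /coverE insubN. Qed.

Lemma coverP u (f g : cover_part u) : coverE f =1 coverE g -> f = g.
Proof. by move=> fg; apply/ffunP=> t; rewrite -!coverE_val. Qed.

Lemma coverE_ffun u (h : 'X_{1..n} * nat -> F) x :
  coverE ([ffun t => h (val t)] : cover_part u) x =
  if x \in cover_gens u then h x else 0.
Proof.
by rewrite /coverE; case: insubP => [t -> <-|/negPf->] //; rewrite ffunE.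
Qed.

Lemma coverE_lin u a (f g : cover_part u) x :
  coverE (a *: f + g) x = a * coverE f x + coverE g x.
Proof.
by rewrite /coverE; case: insubP => [t _ _|_]; rewrite ?ffunE ?mulr0 ?addr0.
Qed.

Definition cover_mul_fun u v (f : cover_part u) : cover_part v :=
  [ffun t => coverE f (val t)].

Fact cover_mul_linear u v : linear (@cover_mul_fun u v).
Proof. by move=> a f g; apply/ffunP=> t; rewrite !ffunE coverE_lin. Qed.
HB.instance Definition _ u v :=
  GRing.isLinear.Build F (cover_part u) (cover_part v) _ (@cover_mul_fun u v)
    (@cover_mul_linear u v).

Definition cover_mul u v : 'Hom(cover_part u, cover_part v) :=
  linfun (@cover_mul_fun u v).

Lemma cover_gensS u v x :
  (u <= v)%MM -> x \in cover_gens u -> x \in cover_gens v.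
Proof.
by move=> uv; rewrite !mem_cover_gens => /andP[/lepm_trans->].
Qed.

Lemma cover_mul_funE u v (f : cover_part u) x :
  (u <= v)%MM -> coverE (cover_mul_fun v f) x = coverE f x.
Proof.
move=> uv; rewrite coverE_ffun; case: ifPn => // xv.
by rewrite coverE_out //; apply: contra xv; apply: cover_gensS.
Qed.

Lemma cover_mulE u v f x :
  (u <= v)%MM -> coverE (cover_mul u v f) x = coverE f x.
Proof. by rewrite lfunE; exact: cover_mul_funE. Qed.

Fact cover_mul_id u f : cover_mul u u f = f.
Proof. by apply: coverP => x; rewrite cover_mulE ?lepm_refl. Qed.

Fact cover_mul_comp u v w : (u <= v)%MM -> (v <= w)%MM -> forall f,
  cover_mul v w (cover_mul u v f) = cover_mul u w f.
Proof.
by move=> uv vw f; apply: coverP => x; rewrite !cover_mulE ?(lepm_trans uv vw).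
Qed.

Definition free_cover : gmodule F n := GModule cover_mul_id cover_mul_comp.

Definition cover_delta u (x : 'X_{1..n} * nat) : cover_part u :=
  [ffun t => (val t == x)%:R].

Lemma cover_deltaE u x y :
  coverE (cover_delta u x) y = if y \in cover_gens u then (y == x)%:R else 0.
Proof. exact: (coverE_ffun _ (fun z => (z == x)%:R)). Qed.

Lemma free_cover_free : gfree free_cover.
Proof.
exists (fun v => [seq cover_delta v (v, k) | k <- iota 0 (\dim {: M v}%VS)]).
move=> u; set B := flatten _.
have -> : B = [seq cover_delta u x | x <- cover_gens u].
  rewrite /B /cover_gens map_allpairs; congr flatten.
  apply/eq_in_map => v; rewrite mem_grades_below => vu; rewrite -map_comp.
  apply/eq_in_map => k; rewrite mem_iota add0n /= => kv.
  apply: coverP => x.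
  transitivity (coverE (cover_delta v (v, k)) x); first exact: cover_mulE.
  rewrite 2!cover_deltaE; case: (eqVneq x (v, k)) => [->|_]; last by rewrite !if_same.
  by rewrite !mem_cover_gens /= vu lepm_refl kv.
rewrite basisEdim; apply/andP; split; last first.
  rewrite size_map dimvf /dim /= muln1 card_seq_sub ?cover_gens_uniq //.
apply/subvP => f _.
have -> : f = \sum_(t : seq_sub (cover_gens u)) f t *: cover_delta u (val t).
  apply/ffunP=> t; rewrite sum_ffunE (bigD1 t) //= !ffunE eqxx.
  rewrite -[_ *: _]/(_ * _) mulr1 big1 ?addr0 // => s st.
  by rewrite !ffunE (inj_eq val_inj) eq_sym (negPf st) scaler0.
apply: memv_suml => t _; apply/memvZ/memv_span/map_f; exact: valP.
Qed.

Definition cover_vec u (x : 'X_{1..n} * nat) : M u :=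
  gmul M x.1 u (vbasis {: M x.1}%VS)`_x.2.

Definition cover_aug_fun u (f : cover_part u) : M u :=
  \sum_(x <- cover_gens u) coverE f x *: cover_vec u x.

Fact cover_aug_linear u : linear (@cover_aug_fun u).
Proof.
move=> a f g; rewrite /cover_aug_fun scaler_sumr -big_split /=.
by apply: eq_bigr => x _; rewrite coverE_lin scalerDl scalerA.
Qed.
HB.instance Definition _ u :=
  GRing.isLinear.Build F (cover_part u) (M u) _ (@cover_aug_fun u)
    (@cover_aug_linear u).

Fact cover_augM u v : (u <= v)%MM -> forall f : free_cover u,
  (linfun (@cover_aug_fun v) : 'Hom(free_cover v, M v)) (gmul free_cover u v f)
  = gmul M u v (linfun (@cover_aug_fun u) f).
Proof.
move=> uv f; rewrite !lfunE /= /cover_aug_fun linear_sum /=.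
have fE x : coverE (cover_mul_fun v f) x = coverE f x.
  exact: cover_mul_funE.
under eq_bigr do rewrite fE.
rewrite (bigID (mem (cover_gens u))) /= [X in _ + X]big1 ?addr0; last first.
  by move=> x /coverE_out->; rewrite scale0r.
rewrite -big_filter.
have Puv : perm_eq [seq x <- cover_gens v | x \in cover_gens u] (cover_gens u).
  apply: uniq_perm; rewrite ?filter_uniq ?cover_gens_uniq // => x.
  by rewrite mem_filter andb_idr //; apply: cover_gensS.
rewrite (perm_big _ Puv) /=; rewrite big_seq [RHS]big_seq; apply: eq_bigr => x.
by rewrite mem_cover_gens => /andP[xu _]; rewrite linearZ /= gmul_comp.
Qed.

Definition cover_aug : gmorphism free_cover M := GMorphism cover_augM.

Lemma cover_aug_surj u : limg (cover_aug u) = fullv.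
Proof.
apply/eqP; rewrite eqEsubv subvf -(span_basis (vbasisP fullv)).
apply/span_subvP => m /(nthP 0)[k]; rewrite size_tuple => ku <-.
have xu : (u, k) \in cover_gens u by rewrite mem_cover_gens lepm_refl.
suff <- : cover_aug u (cover_delta u (u, k)) = (vbasis {: M u}%VS)`_k.
  by rewrite memv_img ?memvf.
rewrite lfunE /= /cover_aug_fun (bigD1_seq _ xu (cover_gens_uniq u)) /=.
rewrite cover_deltaE xu eqxx scale1r /cover_vec gmul_id.
rewrite big1 ?addr0 // => x xk.
by rewrite cover_deltaE (negPf xk) if_same scale0r.
Qed.

End FreeCover.

Section Kernel.
Variables (M N : gmodule F n) (f : gmorphism M N).

Definition ker_part u : vectType F := subvs_of (lker (f u)).

Definition ker_mul u v : 'Hom(ker_part u, ker_part v) :=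
  (linfun (vsproj (lker (f v))) \o
    (gmul M u v \o linfun (@vsval F (M u) (lker (f u)))))%VF.

Lemma ker_mulE u v k : (u <= v)%MM ->
  vsval (ker_mul u v k) = gmul M u v (vsval k).
Proof.
move=> uv; rewrite /ker_mul 2!comp_lfunE !lfunE /= vsprojK //.
by rewrite memv_ker gfunM // (eqP (_ : f u (vsval k) == 0)) ?linear0 //
  -memv_ker subvsP.
Qed.

Fact ker_mul_id u k : ker_mul u u k = k.
Proof. by apply: val_inj; rewrite /= ker_mulE ?lepm_refl // gmul_id. Qed.

Fact ker_mul_comp u v w : (u <= v)%MM -> (v <= w)%MM -> forall k,
  ker_mul v w (ker_mul u v k) = ker_mul u w k.
Proof.
move=> uv vw k; apply: val_inj.
by rewrite /= !ker_mulE ?(lepm_trans uv vw) // gmul_comp.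
Qed.

Definition gker : gmodule F n := GModule ker_mul_id ker_mul_comp.

Fact ker_inclM u v : (u <= v)%MM -> forall k : gker u,
  linfun (@vsval F (M v) (lker (f v))) (gmul gker u v k) =
  gmul M u v (linfun (@vsval F (M u) (lker (f u))) k).
Proof.
move=> uv k; transitivity (vsval (ker_mul u v k)); first exact: lfunE.
by rewrite ker_mulE //; congr (gmul M u v _); rewrite lfunE.
Qed.

Definition ker_incl : gmorphism gker M := GMorphism ker_inclM.

Lemma ker_inclE u k : ker_incl u k = vsval k.
Proof. exact: lfunE. Qed.

End Kernel.

Section Composition.
Variables (L M N : gmodule F n) (g : gmorphism M N) (f : gmorphism L M).

Fact gcompM u v : (u <= v)%MM -> forall m,
  (g v \o f v)%VF (gmul L u v m) = gmul N u v ((g u \o f u)%VF m).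
Proof. by move=> uv m; rewrite !comp_lfunE !gfunM. Qed.

Definition gcomp : gmorphism L N := GMorphism gcompM.

End Composition.

Fixpoint syzygy M (i : nat) : gmodule F n :=
  if i is i'.+1 then gker (cover_aug (syzygy M i')) else M.

Definition std_d M i :
    gmorphism (free_cover (syzygy M i.+1)) (free_cover (syzygy M i)) :=
  gcomp (ker_incl (cover_aug (syzygy M i))) (cover_aug (syzygy M i.+1)).

Lemma limg_std_d M i u :
  limg (std_d M i u) = lker (cover_aug (syzygy M i) u).
Proof.
rewrite limg_comp cover_aug_surj; apply/vspaceP => p.
apply/memv_imgP/idP => [[k _ ->]|pK]; first by rewrite ker_inclE subvsP.
by exists (vsproj (lker (cover_aug (syzygy M i) u)) p);
  rewrite ?memvf // ker_inclE vsprojK.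
Qed.

Lemma lker_std_d M i u :
  lker (std_d M i u) = lker (cover_aug (syzygy M i.+1) u).
Proof.
apply/vspaceP => p; rewrite !memv_ker comp_lfunE ker_inclE.
by rewrite -(inj_eq val_inj).
Qed.

Definition std_resolution M : free_resolution M.
Proof.
apply: (@FreeResolution M (fun i => free_cover (syzygy M i)) (std_d M)
          (cover_aug M)) => [i|u|u|i u].
- exact: free_cover_free.
- exact: cover_aug_surj.
- exact: limg_std_d.
- by rewrite limg_std_d lker_std_d.
Defined.

End Resolutions.

Arguments res_d {F n M} f i.

(* Main.v *)
(** Write [V = Z / B] for cycles modulo boundaries, and let [eps : P_0 -> V] be
    the augmentation, with kernel [K]. In degree [u], [Tor_1 (V, F)] vanishes as
    soon as every [k = \sum_i x_i p_i] in [K] can be rewritten as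
    [\sum_i x_i k_i] with all [k_i] in [K]. Let [r_i] be a cycle representing
    [eps p_i]; then [\sum_i r_i] is a boundary. If no [(q+1)]-cell enters at
    [u], it is [\sum_i b_i] with [b_i] a boundary of [X^(u - e_i)], so the
    cycles [z_i = r_i - b_i] add up to [0]. If [u] is not a join of grades of
    [q]-cells, there is a [j] such that every [q]-cell of [X^u] lies in
    [X^(u - e_j)]. Hence, for [i <> j], [z_i] is a cycle of
    [X^(u - e_i - e_j)], so its class is [eps w_i] for some [w_i], and
    [k_i = p_i - x_j w_i], [k_j = p_j + \sum_(i <> j) x_i w_i] is the desired
    rewriting. *)

Require Import Defs.
From HB Require Import structures.
From mathcomp Require Import all_boot all_order all_algebra.
From mathcomp.multinomials Require Import mpoly.

Set Implicit Arguments.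
Unset Strict Implicit.
Unset Printing Implicit Defensive.

Import GRing.Theory.
Local Open Scope ring_scope.

(** * Order on grades and zero subquotients *)

Lemma mnm_le_subU (n : nat) (a v : 'X_{1..n}) (j : 'I_n) :
  (a <= v)%MM -> (a j < v j)%N -> (a <= v - U_(j))%MM.
Proof.
move=> /mnm_lepP av aj; apply/mnm_lepP => l; rewrite mnmBE mnm1E.
case: eqP => [<-|_] /=; rewrite ?subn0 //.
by rewrite leq_subRL ?add1n // (leq_trans _ aj).
Qed.

Lemma lem_subl (n : nat) (u v w : 'X_{1..n}) :
  (u <= v)%MM -> (u - w <= v - w)%MM.
Proof.
by move=> /mnm_lepP uv; apply/mnm_lepP => l; rewrite !mnmBE leq_sub2r.
Qed.

Lemma big_mlcm_le (n : nat) (L : seq 'X_{1..n}) (v : 'X_{1..n}) :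
  (\big[@mlcm n/0%MM]_(a <- L) a <= v)%MM = all (fun a => a <= v)%MM L.
Proof.
elim: L => [|a L IH]; last by rewrite big_cons lem_mlcm IH.
by rewrite big_nil; apply/mnm_lepP => l; rewrite mnm0E.
Qed.

Lemma subquot_dim_eq0 (F : fieldType) (vT : vectType F) (W U : {vspace vT}) :
  (W <= U)%VS -> \dim {: subquot W U} = 0%N.
Proof.
move=> WU; suff -> : (fullv : {vspace subquot W U}) = 0%VS by rewrite dimv0.
apply/eqP; rewrite -subv0; apply/subvP => c _.
have [w wW <-] := qclass_surj c.
by rewrite memv0 qclass_eq0 // (subvP WU).
Qed.

(** * A vanishing criterion for [Tor_1] *)

Section Tor1.
Variables (F : fieldType) (n : nat) (M : gmodule F n).
Variable P : free_resolution M.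

(** A class of [Tor_1] comes from some [p] in [P 1] whose differential lies in both spaces
    intersected on the left. As [lker (res_aug P u)] is the image of the differential, the inclusion
    yields [p'] in the irrelevant part of [P 1] with the same differential; then [p - p'] comes from
    [P 2], by exactness. *)
Lemma xi1_eq0 (u : 'X_{1..n}) :
  (lker (res_aug P u) :&: irrelevant (P 0%N) u <=
     \sum_(i < n | (U_(i) <= u)%MM)
        gmul (P 0%N) (u - U_(i))%MM u @: lker (res_aug P (u - U_(i))%MM))%VS ->
  xi1 P u = 0%N.
Proof.
move=> sub; apply: subquot_dim_eq0; apply/subvP => c.
have [p _ <-] := qclass_surj c.
rewrite memv_ker tensF_map_class qclass_eq0 ?memvf // => dpI.
have : res_d P 0%N u p \in (lker (res_aug P u) :&: irrelevant (P 0%N) u)%VS.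
  by rewrite memv_cap dpI -res_exact0 memv_img ?memvf.
move=> /(subvP sub) dpK.
have /memv_imgP[p' p'I dpE] : res_d P 0%N u p \in
    (res_d P 0%N u @: irrelevant (P 1%N) u)%VS.
  apply: subvP dpK; apply/subv_sumP => i iu.
  rewrite -res_exact0 /irrelevant limg_sum.
  apply: subv_trans (sumv_sup i iu (subvv _)).
  apply/subvP => _ /memv_imgP[_ /memv_imgP[x _ ->] ->].
  by rewrite -gfunM ?lem_subr // !memv_img ?memvf.
have : p - p' \in lker (res_d P 0%N u) by rewrite memv_ker linearB /= dpE subrr.
rewrite -res_exact => /memv_imgP[p2 _ pE].
rewrite -[p](subrK p') pE linearD /=.
have /eqP -> : qclass fullv (irrelevant (P 1%N) u) p' == 0.
  by rewrite qclass_eq0 ?memvf.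
by rewrite addr0 -tensF_map_class memv_img ?memvf.
Qed.

End Tor1.

(** * Cycles and boundaries along the filtration *)

Section OneCritical.
Variables (F : fieldType) (X : cellComplex F) (n q : nat).

(** The kernel of [boundary] is taken in the whole chain space, so the [q]-cells alone decide the
    inclusion. *)
Lemma cycles_le (A B : {set X}) :
  (forall s, cdim s = q -> s \in A -> s \in B) -> (cycles A q <= cycles B q)%VS.
Proof.
move=> AB; apply: capvS (subvv _); apply: sub_span => f /mapP[s + ->].
rewrite mem_filter mem_enum => /andP[/eqP sq /(AB _ sq) sB]; apply: map_f.
by rewrite mem_filter mem_enum /= sq eqxx.
Qed.

Variables (Xf : filtration X n) (P : free_resolution (homology_module Xf q)).

Lemma boundaries_decomp (u : 'X_{1..n}) :
  (forall s, cdim s = q.+1 -> s \in Xf u ->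
     exists2 i, (U_(i) <= u)%MM & s \in Xf (u - U_(i))%MM) ->
  (boundaries (Xf u) q <=
     \sum_(i < n | (U_(i) <= u)%MM) boundaries (Xf (u - U_(i))%MM) q)%VS.
Proof.
move=> no_entrance; rewrite /boundaries -limg_sum; apply: limgS.
apply/span_subvP => f /mapP[s + ->].
rewrite mem_filter mem_enum => /andP[/eqP sq /(no_entrance _ sq)[i iu si]].
apply: (subvP (sumv_sup i iu (subvv _))); apply/memv_span/map_f.
by rewrite mem_filter mem_enum /= sq eqxx.
Qed.

Lemma xi1_homology_eq0 (u : 'X_{1..n}) (j : 'I_n) : (U_(j) <= u)%MM ->
  (forall i s, i != j -> (U_(i) <= u)%MM -> cdim s = q ->
     s \in Xf (u - U_(i))%MM -> s \in Xf (u - U_(i) - U_(j))%MM) ->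
  (forall s, cdim s = q.+1 -> s \in Xf u ->
     exists2 i, (U_(i) <= u)%MM & s \in Xf (u - U_(i))%MM) ->
  xi1 P u = 0%N.
Proof.
move=> ju shift no_entrance; apply: xi1_eq0; apply/subvP => k.
rewrite memv_cap memv_ker => /andP[/eqP k0 /memv_sumP[xs xsI kE]].
pose cl v := qclass (cycles (Xf v) q) (boundaries (Xf v) q).
have clM v v' z : (v <= v')%MM -> z \in cycles (Xf v) q ->
    gmul (homology_module Xf q) v v' (cl v z) = cl v' z.
  by move=> vv'; apply: homology_inclE; apply: fsub_mono.
have BZ v : (boundaries (Xf v) q <= cycles (Xf v) q)%VS.
  exact: boundaries_sub_cycles (@fsub_subcomplex _ _ _ Xf v).
have cl0 v b : b \in boundaries (Xf v) q -> cl v b = 0.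
  by move=> bB; apply/eqP; rewrite qclass_eq0 // (subvP (BZ v)).
(* A preimage of [xs i] under multiplication by x_i, meaningful only when e_i is below [u]. *)
pose p i : P 0%N (u - U_(i))%MM :=
  ((gmul (P 0%N) (u - U_(i))%MM u)^-1)%VF (xs i).
have xsE i : (U_(i) <= u)%MM -> xs i = gmul (P 0%N) (u - U_(i))%MM u (p i).
  by move=> iu; rewrite limg_lfunVK ?xsI.
pose r i : chain_space X := vsval (res_aug P (u - U_(i))%MM (p i)).
have rZ i : r i \in cycles (Xf (u - U_(i))%MM) q by apply: vsval_subquot.
have clr i : cl (u - U_(i))%MM (r i) = res_aug P _ (p i) by apply: qclassK.
have rZu i : r i \in cycles (Xf u) q.
  by apply: (subvP (cyclesS q (fsub_mono Xf (lem_subr _ _)))).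
(* The class of this sum in H_q(X^u) is the augmentation of [k], which is 0. *)
have : \sum_(i < n | (U_(i) <= u)%MM) r i \in boundaries (Xf u) q.
  rewrite -(@qclass_eq0 _ _ (cycles (Xf u) q)) ?memv_suml //.
  apply/eqP; rewrite -/(cl u) linear_sum /= -[RHS]k0 kE linear_sum /=.
  apply: eq_bigr => i iu; rewrite xsE // (gfunM (res_aug P)) ?lem_subr // -clr.
  by rewrite clM ?lem_subr.
move=> /(subvP (boundaries_decomp no_entrance))/memv_sumP[b bB rE].
pose z i := r i - b i.
have zZ i : (U_(i) <= u)%MM -> z i \in cycles (Xf (u - U_(i))%MM) q.
  by move=> iu; rewrite memvB // (subvP (BZ _)) ?bB.
have clz i : (U_(i) <= u)%MM -> cl (u - U_(i))%MM (z i) = res_aug P _ (p i).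
  by move=> iu; rewrite linearB /= clr cl0 ?bB // subr0.
have z0 : \sum_(i < n | (U_(i) <= u)%MM) z i = 0.
  by rewrite sumrB rE subrr.
have zZj i : i != j -> (U_(i) <= u)%MM ->
    z i \in cycles (Xf (u - U_(i) - U_(j))%MM) q.
  by move=> ij iu; apply: (subvP (cycles_le _) _ (zZ i iu)) => s; apply: shift.
pose w i : P 0%N (u - U_(i) - U_(j))%MM := ((res_aug P _)^-1)%VF (cl _ (z i)).
have wE i : res_aug P _ (w i) = cl (u - U_(i) - U_(j))%MM (z i).
  by rewrite limg_lfunVK // res_aug_surj memvf.
have ij_le_j i : (u - U_(i) - U_(j) <= u - U_(j))%MM.
  by rewrite lem_subl ?lem_subr.
(* The terms in [w i] cancel: both routes multiply it by x_i x_j. *)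
have -> : k =
    gmul (P 0%N) (u - U_(j))%MM u
      (p j + \sum_(i < n | (U_(i) <= u)%MM && (i != j))
         gmul (P 0%N) (u - U_(i) - U_(j))%MM (u - U_(j))%MM (w i)) +
    \sum_(i < n | (U_(i) <= u)%MM && (i != j))
      gmul (P 0%N) (u - U_(i))%MM u
        (p i - gmul (P 0%N) (u - U_(i) - U_(j))%MM (u - U_(i))%MM (w i)).
  rewrite kE (bigD1 j) //= linearD /= -xsE // -addrA; congr (_ + _).
  rewrite linear_sum -big_split /=; apply: eq_bigr => i /andP[iu _].
  rewrite linearB /= -xsE // !gmul_comp ?lem_subr ?ij_le_j //.
  by rewrite addrC subrK.
(* For i <> j, [p i] and x_j [w i] both have the class of [z i] as augmentation. *)
apply: memvD; last first.
  apply: memv_suml => i /andP[iu ij].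
  apply: (subvP (sumv_sup i iu (subvv _))); rewrite memv_img // memv_ker.
  rewrite linearB /= (gfunM (res_aug P)) ?lem_subr // wE clM ?lem_subr ?zZj //.
  by rewrite clz // subrr.
(* In degree u - e_j the augmentation is the class of the sum of all [z i], which is 0. *)
apply: (subvP (sumv_sup j ju (subvv _))); rewrite memv_img // memv_ker.
rewrite linearD linear_sum /= -clz //.
under eq_bigr => i /andP[iu ij].
  rewrite (gfunM (res_aug P)) // wE clM ?zZj //; over.
by rewrite -linear_sum -linearD /= -(bigD1 j) //= z0 linear0.
Qed.

(** This rules out the empty join, whose value is 0: no variable reaches degree 0, so [irrelevant]
    vanishes there. *)
Lemma xi1_homology_degree0 : xi1 P 0%MM = 0%N.
Proof.
apply: xi1_eq0; apply: subv_trans (capvSr _ _) _.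
rewrite /irrelevant big_pred0 ?sub0v // => i; apply/negbTE/negP.
by move=> /mnm_lepP/(_ i); rewrite mnm1E eqxx mnm0E.
Qed.

Lemma entrance_grade_critical (h : X -> 'X_{1..n}) :
  (forall u, Xf u = [set s | (h s <= u)%MM]) ->
  forall s, entrance_grade Xf s (h s).
Proof.
move=> XfE s; split=> [|j js]; rewrite XfE inE ?lepm_refl //.
apply/negP => /mnm_lepP/(_ j); move: js => /mnm_lepP/(_ j).
by rewrite mnmBE mnm1E eqxx; case: (h s j) => // m _; rewrite subn1 ltnn.
Qed.

Lemma xi1_homology_supp (u : 'X_{1..n}) : one_critical Xf -> xi1 P u <> 0%N ->
  entrance_grades Xf q.+1 u \/ join_closure (entrance_grades Xf q) u.
Proof.
move=> [h [_ XfE]] xi_neq0; have hE := entrance_grade_critical XfE.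
have [/existsP[s /andP[/eqP sq /eqP <-]] | /existsPn no_cell] :=
    boolP [exists s : X, (cdim s == q.+1) && (h s == u)].
  by left; exists s.
pose L := [seq h s | s <- enum X & (cdim s == q) && (h s <= u)%MM].
(* If [u] is a join of grades of [q]-cells, it is already the join [m] of all those below it. *)
pose m := \big[@mlcm n/0%MM]_(a <- L) a.
have memL s : cdim s = q -> (h s <= u)%MM -> h s \in L.
  by move=> sq su; apply: map_f; rewrite mem_filter mem_enum sq eqxx su.
have leL s : cdim s = q -> (h s <= u)%MM -> (h s <= m)%MM.
  move=> sq su; have := lepm_refl m; rewrite big_mlcm_le => /allP.
  by apply; apply: memL.
have mu : (m <= u)%MM.
  by rewrite big_mlcm_le; apply/allP => _ /mapP[s + ->];
     rewrite mem_filter => /andP[/andP[]].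
have [mE | m_neq_u] := eqVneq m u.
  right; exists L; split=> // [L0 | v /mapP[s + ->]].
    apply: xi_neq0; rewrite -mE /m L0 big_nil.
    exact: xi1_homology_degree0.
  by rewrite mem_filter => /andP[/andP[/eqP sq _] _]; exists s.
have lt_coord a : (a <= u)%MM -> a != u -> exists j, (a j < u j)%N.
  move=> /mnm_lepP au; case: (pickP (fun j => a j < u j)%N) => [j|no_j].
    by exists j.
  by case/eqP; apply/mnmP => l; apply/eqP; rewrite eqn_leq au leqNgt no_j.
have posU i v : (U_(i) <= v)%MM = (0 < v i)%N.
  apply/mnm_lepP/idP => [/(_ i)|vi l]; first by rewrite mnm1E eqxx.
  by rewrite mnm1E; case: eqP => [<-|].
(* Every [q]-cell of X^u has grade at most [m], so its j-th coordinate is smaller than that of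
   [u]. *)
have [j mj] := lt_coord m mu m_neq_u.
have ju : (U_(j) <= u)%MM by rewrite posU (leq_ltn_trans _ mj).
case: xi_neq0; apply: (xi1_homology_eq0 ju) => [i s ij iu sq | s sq].
  rewrite !XfE !inE => si.
  have su := lepm_trans si (lem_subr _ _).
  apply: mnm_le_subU si _.
  (* As i <> j, subtracting e_i keeps the j-th coordinate of [u]. *)
  rewrite mnmBE mnm1E (negPf ij) subn0.
  by apply: leq_ltn_trans mj; move/mnm_lepP: (leL s sq su).
rewrite XfE inE => su.
have hs_neq_u : h s != u by have := no_cell s; rewrite sq eqxx.
have [i si] := lt_coord _ su hs_neq_u.
exists i; first by rewrite posU (leq_ltn_trans _ si).
by rewrite XfE inE mnm_le_subU.
Qed.

End OneCritical.

Theorem corollary5p20 (F : fieldType) (X : cellComplex F) (n : nat)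
    (hn : (1 <= n)%N) (q : nat) (Xf : filtration X n)
    (hcrit : one_critical Xf) (hexh : exhaustive Xf)
    (P : free_resolution (homology_module Xf q)) :
  (forall u : 'X_{1..n},
     ~ (entrance_grades Xf q.+1 u \/ join_closure (entrance_grades Xf q) u) ->
     xi1 P u = 0%N) /\
  (forall u : 'X_{1..n}, xi1 P u <> 0%N ->
     entrance_grades Xf q.+1 u \/ join_closure (entrance_grades Xf q) u).
Proof.
split=> u; last exact: xi1_homology_supp.
move=> not_supp; have [//|/eqP xi_neq0] := eqVneq (xi1 P u) 0%N.
by case: not_supp; apply: xi1_homology_supp xi_neq0.
Qed.
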